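(* Let $K>0$ be a real constant, let $r$ be a real parameter, and consider the difference equation $$X_{n+1} = X_{n} + r X_{n}\left(1-\frac{X_{n-\tau}}{K}\right)$$ for any integer $\tau\ge 0$. Then there are always two fixed points, $X_1 = \underbrace{(0, 0, \ldots, 0)}_{\tau+1}$ and $X_2 = \underbrace{(K, K, \ldots, K)}_{\tau+1}$, and $X_1$ is stable if $-2<r<0$.
   Context: The difference equation (the discrete logistic equation with time delay $\tau$) is regarded as the discrete dynamical system on $\mathbb{R}^{\tau+1}$ obtained by iterating the map $$F(x_0,x_1,\ldots,x_\tau)=\left(x_1,x_2,\ldots,x_\tau,\; x_\tau+r x_\tau\left(1-\frac{x_0}{K}\right)\right),$$ where $(x_0,\ldots,x_\tau)$ stands for $(X_{n-\tau},\ldots,X_n)$; for $\tau=0$ this is $F(x_0)=x_0+rx_0(1-x_0/K)$. A fixed point is a point $X\in\mathbb{R}^{\tau+1}$ with $F(X)=X$. A fixed point is called stable if all (complex) eigenvalues of the Jacobian matrix of $F$ at that point have modulus strictly less than $1$ (the standard linear stability test). *)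

(* Defs.v *)
From HB Require Import structures.
From mathcomp Require Import all_boot all_order all_algebra.
From mathcomp Require Import complex.
From mathcomp Require Import all_classical all_reals all_analysis.

Set Implicit Arguments.
Unset Strict Implicit.
Unset Printing Implicit Defensive.

Import Order.TTheory GRing.Theory Num.Theory.
Import numFieldNormedType.Exports.

Local Open Scope ring_scope.

(* The state x = (x_0, ..., x_tau) stands for (X_{n-tau}, ..., X_n). In the
   first branch i < tau, so [inord i.+1] is the index i + 1; for tau = 0 only
   the second branch occurs, and ord0 = ord_max. *)
Definition delay_logistic (R : realType) (tau : nat) (K r : R)
    (x : 'rV[R]_tau.+1) : 'rV[R]_tau.+1 :=
  \row_(i < tau.+1)
    if (i < tau)%N then x 0 (inord i.+1)
    else x 0 ord_max + r * x 0 ord_max * (1 - x 0 ord0 / K).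

Definition fixed_point (T : Type) (F : T -> T) (p : T) : Prop := F p = p.

(* ['J F p] acts on row vectors from the right, i.e. it is the transpose of the
   matrix of partial derivatives (dF_i / dx_j), which has the same eigenvalues.
   It is only meaningful where F is differentiable, hence the second clause. *)
Definition stable_fixed_point (R : realType) (n : nat)
    (F : 'rV[R]_n -> 'rV[R]_n) (p : 'rV[R]_n) : Prop :=
  [/\ fixed_point F p,
      differentiable F p &
      forall z : R[i],
        eigenvalue (map_mx (real_complex R) ('J F p)) z -> `|z| < 1].

Lemma delay_logisticP (R : realType) (tau : nat) (K r : R) (X : nat -> R) :
  let state n : 'rV[R]_tau.+1 := \row_(i < tau.+1) X (n + i)%N in
  (forall n, state n.+1 = delay_logistic K r (state n)) <->
  (forall n, (tau <= n)%N ->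
     X n.+1 = X n + r * X n * (1 - X (n - tau)%N / K)).
Proof.
move=> state; split=> [H n le_tn|H n].
  have /rowP/(_ ord_max) := H (n - tau)%N.
  by rewrite !mxE /= ltnn addn0 addSn subnK.
apply/rowP => i; rewrite !mxE.
case: ltnP => [lt_it|le_ti]; first by rewrite inordK ?ltnS // addnS addSn.
have -> : nat_of_ord i = tau.
  by apply/eqP; rewrite eqn_leq le_ti -ltnS ltn_ord.
by rewrite /= addn0 addSn H ?leq_addl // addnK.
Qed.

(* Main.v *)
Require Import Defs.
From HB Require Import structures.
From mathcomp Require Import all_boot all_order all_algebra.
From mathcomp Require Import complex.
From mathcomp Require Import all_classical all_reals all_analysis.
From mathcomp Require Import ring lra.

Import Order.TTheory GRing.Theory Num.Theory.
Import numFieldNormedType.Exports.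

Local Open Scope ring_scope.

(** The first [tau] coordinates of [F X = X] say that each coordinate of [X]
    equals the next one, so a fixed point is a constant vector [(c, ..., c)];
    the last coordinate then reads [r c (1 - c / K) = 0], whose solutions for
    nonzero [r] are [c = 0] and [c = K] ([fixed_point_delay_logistic]).

    For stability at the origin, write [F] as a linear map plus the quadratic
    term [- (r / K) x_0 x_tau] in the last coordinate ([delay_logisticE]). The
    quadratic term has derivative zero at the origin, so the Jacobian there is
    the linear part: a shift of the coordinates whose last entry is multiplied
    by [1 + r] ([jacobian_delay_logistic0]). The delayed value [x_0] has dropped
    out, and this is why the stability interval does not depend on [tau]: an
    eigenvector [v] with a nonzero eigenvalue [z] satisfies [v_(i+1) = z v_i],
    so it vanishes as soon as its last coordinate does, and the last coordinate
    equation [(1 + r) v_tau = z v_tau] forces [z = 1 + r]. The spectrum is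
    therefore contained in [{0, 1 + r}] ([eigenvalue_shift_mx]), and
    [|1 + r| < 1] exactly when [-2 < r < 0]. *)

(** The matrix acts on row vectors from the right, as the Jacobian does. It is
    defined over an arbitrary ring because the eigenvalues are those of its
    image over the complex numbers. *)
Definition shift_mx (S : pzRingType) (tau : nat) (a : S) : 'M[S]_tau.+1 :=
  \matrix_(i, j)
    if (j < tau)%N then (i == inord j.+1)%:R else a *+ (i == ord_max).

Lemma mul_rV_shift (S : pzRingType) tau (a : S) (v : 'rV[S]_tau.+1) j :
  (v *m shift_mx S tau a) 0 j =
  if (j < tau)%N then v 0 (inord j.+1) else v 0 ord_max * a.
Proof.
rewrite mxE; case: ifPn => jt.
  rewrite (bigD1 (inord j.+1)) //= big1 => [|i ne]; rewrite !mxE jt.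
    by rewrite eqxx mulr1 addr0.
  by rewrite (negPf ne) mulr0.
rewrite (bigD1 ord_max) //= big1 => [|i ne]; rewrite !mxE (negPf jt).
  by rewrite eqxx addr0.
by rewrite (negPf ne) mulr0.
Qed.

Lemma map_shift_mx (S T : pzRingType) (f : {rmorphism S -> T}) tau a :
  map_mx f (shift_mx S tau a) = shift_mx T tau (f a).
Proof.
apply/matrixP => i j; rewrite !mxE.
by case: ifP => _; rewrite ?rmorph_nat // rmorphMn.
Qed.

(** Descending induction on the coordinates. It serves twice: for an
    eigenvector of the shift, and for the difference between a fixed point and
    a constant vector. *)
Lemma rV_eq0_of_chain (S : pzSemiRingType) tau (v : 'rV[S]_tau.+1) :
  v 0 ord_max = 0 ->
  (forall i : 'I_tau.+1, (i < tau)%N -> v 0 (inord i.+1) = 0 -> v 0 i = 0) ->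
  v = 0.
Proof.
move=> v0 step.
suff H k (i : 'I_tau.+1) : (i + k)%N = tau -> v 0 i = 0.
  apply/rowP => i; rewrite mxE; apply: (H (tau - i)%N).
  by rewrite subnKC // -ltnS ltn_ord.
elim: k i => [|k IH] i ik.
  by rewrite (_ : i = ord_max) //; apply/val_inj; rewrite -[LHS]addn0 ik.
have it : (i < tau)%N by rewrite -[X in (_ < X)%N]ik addnS ltnS leq_addr.
by apply: step => //; apply: IH; rewrite inordK ?ltnS // addSnnS.
Qed.

(** If [z] is neither [0] nor [a], the last coordinate of [v *m A = z *: v]
    gives [v_tau = 0], and the other ones, [v_(i+1) = z v_i], propagate this
    zero down to [v_0]. *)
Lemma eigenvalue_shift_mx (S : fieldType) tau (a z : S) :
  eigenvalue (shift_mx S tau a) z -> z = 0 \/ z = a.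
Proof.
case/eigenvalueP => v /rowP vA; apply: contra_neqP => /not_orP[/eqP z0 za].
apply: rV_eq0_of_chain => [|i it vi].
  have := vA ord_max; rewrite mul_rV_shift ltnn mxE mulrC => /eqP.
  rewrite -subr_eq0 -mulrBl mulf_eq0 subr_eq0 => /orP[/eqP az|/eqP //].
  by case: za.
have := vA i; rewrite mul_rV_shift it vi mxE => /esym/eqP.
by rewrite mulf_eq0 (negPf z0) => /eqP.
Qed.

(** The product is a combination of the rows of [A] whose coefficients are the
    coordinate functions, which are differentiable. *)
Lemma mulmxr_rV_continuous (R : numFieldType) m n (A : 'M[R]_(m.+1, n.+1)) :
  continuous (mulmxr A : 'rV[R]_m.+1 -> 'rV[R]_n.+1).
Proof.
move=> v.
have dcoord (i : 'I_m.+1) :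
    differentiable (fun u : 'rV[R]_m.+1 => u 0 i *: row i A) v.
  have [di _] : is_diff v ( *:%R^~ (row i A) \o (fun u => u 0 i)) _ :=
    is_diff_comp (differentiableP (differentiable_coord v 0 i))
                 (is_diff_scalel _ (row i A)).
  exact: di.
have /differentiable_continuous := differentiable_sum dcoord.
rewrite (_ : \sum_i _ = mulmxr A) //.
by apply/funext => u; rewrite fct_sumE /mulmxr mulmx_sum_row.
Qed.

(** Separating the linear part from the quadratic one; the sum, the product and
    the composition are those of functions, so that the rules of differential
    calculus apply to the right-hand side as it stands. *)
Lemma delay_logisticE (R : realType) tau (K r : R) :
  delay_logistic K r =
  (mulmxr (shift_mx R tau (1 + r)) : 'rV[R]_tau.+1 -> 'rV[R]_tau.+1) +
  (( *:%R^~ (- (r / K) *: delta_mx 0 ord_max)) \o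
   ((fun x : 'rV[R]_tau.+1 => x 0 ord_max) * (fun x => x 0 ord0))).
Proof.
apply/funext => x; apply/rowP => j.
rewrite [RHS]mxE {1}/mulmxr mul_rV_shift !mxE /=; case: ltnP => jt.
  rewrite (_ : (j == ord_max) = false) ?andbF ?mulr0 ?addr0 //.
  by apply/eqP => jE; move: jt; rewrite jE ltnn.
rewrite (_ : j = ord_max) ?eqxx /=; last first.
  by apply/val_inj/eqP; rewrite eqn_leq /= jt -ltnS ltn_ord.
rewrite (_ : (_ * _) x = x 0 ord_max * x 0 ord0) //; ring.
Qed.

(** Both factors of the quadratic term vanish at the origin, hence so does its
    derivative there, by the product rule. *)
Lemma is_diff_delay_logistic0 (R : realType) tau (K r : R) :
  is_diff (0 : 'rV[R]_tau.+1) (delay_logistic K r)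
          (mulmxr (shift_mx R tau (1 + r))).
Proof.
have dcoord (j : 'I_tau.+1) :
    let c (x : 'rV[R]_tau.+1) := x 0 j in is_diff 0 c ('d c 0).
  exact/differentiableP/differentiable_coord.
have dlin : is_diff (0 : 'rV[R]_tau.+1)
    (mulmxr (shift_mx R tau (1 + r)) : 'rV[R]_tau.+1 -> 'rV[R]_tau.+1)
    (mulmxr (shift_mx R tau (1 + r))).
  have cont := @mulmxr_rV_continuous R _ _ (shift_mx R tau (1 + r)).
  by apply: DiffDef; [exact: linear_differentiable | exact: diff_lin].
rewrite delay_logisticE.
pose w : 'rV[R]_tau.+1 := - (r / K) *: delta_mx 0 ord_max.
have dq := is_diffM (dcoord ord_max) (dcoord ord0).
have dn := is_diff_comp dq (is_diff_scalel _ w).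
apply: is_diff_eq (is_diffD dlin dn) _.
apply/funext => v; rewrite -[RHS]addr0; congr (_ + _).
rewrite /= !mxE !scale0r addr0.
exact: scale0r.
Qed.

Lemma jacobian_delay_logistic0 (R : realType) tau (K r : R) :
  'J (@delay_logistic R tau K r) 0 = shift_mx R tau (1 + r).
Proof.
apply/row_matrixP => i; rewrite !rowE mul_rV_lin1.
have [_ dE] := is_diff_delay_logistic0 R tau K r.
by rewrite dE.
Qed.

(** The first [tau] coordinate equations force the vector to be constant, and
    the last one becomes the equation for the common value. *)
Lemma fixed_point_delay_logistic (R : realType) tau (K r : R)
    (X : 'rV[R]_tau.+1) :
  fixed_point (delay_logistic K r) X <->
  exists2 c, X = const_mx c & r * c * (1 - c / K) = 0.
Proof.
split=> [/rowP fixX|[c -> rc]]; last first.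
  by apply/rowP => i; rewrite !mxE rc addr0 if_same.
have := fixX ord_max; rewrite mxE ltnn => /eqP.
rewrite -subr_eq0 addrC addKr => /eqP eqc.
have cst : X = const_mx (X 0 ord_max).
  apply/eqP; rewrite -subr_eq0; apply/eqP; apply: rV_eq0_of_chain.
    by rewrite !mxE subrr.
  by move=> i it; rewrite !mxE -(fixX i) mxE it.
exists (X 0 ord_max) => //.
by rewrite -[RHS]eqc [in X 0 ord0]cst mxE.
Qed.

Lemma normc_real (R : rcfType) (x : R) : `|x%:C%C| = `|x|%:C%C.
Proof. by rewrite normc_def /= expr0n addr0 sqrtr_sqr. Qed.

Theorem proposition3p1 (R : realType) (K r : R) (hK : 0 < K) (tau : nat) :
  let F := @delay_logistic R tau K r in
  let X1 : 'rV[R]_tau.+1 := const_mx 0 in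
  let X2 : 'rV[R]_tau.+1 := const_mx K in
  [/\ fixed_point F X1,
      fixed_point F X2,
      X1 <> X2,
      r <> 0 -> forall X : 'rV[R]_tau.+1, fixed_point F X -> X = X1 \/ X = X2
    & -2 < r < 0 -> stable_fixed_point F X1].
Proof.
have K0 : K != 0 by rewrite gt_eqF.
move=> F X1 X2.
have fix1 : fixed_point F X1.
  by apply/fixed_point_delay_logistic; exists 0 => //; rewrite mulr0 mul0r.
split=> //.
- apply/fixed_point_delay_logistic; exists K => //.
  by rewrite divff // subrr mulr0.
- by move=> /rowP/(_ ord0); rewrite !mxE => /esym/eqP; rewrite (negPf K0).
- move=> /eqP r0 X /fixed_point_delay_logistic[c -> /eqP].
  rewrite !mulf_eq0 (negPf r0) subr_eq0 => /orP[/eqP ->|/eqP cK]; first by left.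
  by right; rewrite -[c](divfK K0) -cK mul1r.
move=> /andP[r2 r0]; split=> //.
  by have [] := is_diff_delay_logistic0 R tau K r.
move=> z; rewrite jacobian_delay_logistic0 map_shift_mx.
case/eigenvalue_shift_mx => ->; first by rewrite normr0 ltr01.
by rewrite normc_real ltcR ltr_norml; apply/andP; split; lra.
Qed.
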